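(* Consider the stochastic process (case 1) describing transmission of photons through a sequence of $M\ge 1$ polarization sensitive elements rotated by angles $\vec\alpha=(\alpha_0,\dots,\alpha_{M-1})$, with $N_0\neq 0$ initial photons, as defined in the context. Then for every $i\in(0,\dots,M-1)$, $$\frac{N_{i+1}(\vec\alpha)}{N_0}=\int_{\theta_i}\frac{N_i(\vec\alpha)}{N_0}\,\rho_{S,i}(\theta_i,\vec\alpha)\,P_{T,i}(\theta_i,\alpha_i)\,\mathrm{d}\theta_i .$$
   Context: Process ''case 1''. Photons pass successively through surfaces $\Sigma_0,\dots,\Sigma_M$; the $i$-th polarization sensitive element ($i=0,\dots,M-1$) lies between $\Sigma_i$ and $\Sigma_{i+1}$ and is rotated by a fixed (non-random) angle $\alpha_i$; $\vec\alpha=(\alpha_0,\dots,\alpha_{M-1})$. The state of a photon at $\Sigma_i$ is a random polarization angle $\theta_i$, ranging over a fixed interval of length $2\pi$ with Lebesgue measure $\mathrm{d}\theta_i$; $\int_{\theta_i}$ denotes integration over this interval. $N_0>0$ photons pass through $\Sigma_0$; different photons are independent. The data are: - $\rho_{S,0}(\theta_0,\vec\alpha)$: the probability density of $\theta_0$ (it does not depend on the element rotations). - $P_{T,i}(\theta_i,\alpha_i)\in[0,1]$, measurable: the conditional probability that a photon with polarization angle $\theta_i$ at $\Sigma_i$ is transmitted through the $i$-th element (otherwise it never reaches $\Sigma_{i+1},\dots,\Sigma_M$). - $\rho_{C,i}(\theta_i,\theta_{i+1},\alpha_i)\ge 0$, jointly measurable in $(\theta_i,\theta_{i+1})$, with $\int_{\theta_{i+1}}\rho_{C,i}(\theta_i,\theta_{i+1},\alpha_i)\,\mathrm{d}\theta_{i+1}=1$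 for all $\theta_i$: the conditional probability density of the outgoing polarization angle $\theta_{i+1}$, given the incoming angle $\theta_i$ and given that the photon was transmitted through the $i$-th element. Memoryless (Markov) property: transmission through the $i$-th element and the resulting angle depend on the past only through $\theta_i$. Derived quantities: $N_i(\vec\alpha)$ is the (expected) number of photons which pass through $\Sigma_i$, i.e. $N_0$ times the probability that a photon reaches $\Sigma_i$ (so $N_0(\vec\alpha)=N_0$); $\rho_{S,i}(\theta_i,\vec\alpha)$ is the probability density of the polarization angle at $\Sigma_i$ conditioned on the photon reaching $\Sigma_i$ (both depend on $\vec\alpha$ at most through $\alpha_0,\dots,\alpha_{i-1}$). If $N_i(\vec\alpha)=0$, the product $N_i(\vec\alpha)\rho_{S,i}(\theta_i,\vec\alpha)$ is understood to be $0$. *)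

(* Defs.v *)
From HB Require Import structures.
From mathcomp Require Import all_boot all_order all_algebra.
From mathcomp Require Import all_classical all_reals all_analysis.
From mathcomp Require Import measurable_realfun.

Set Implicit Arguments.
Unset Strict Implicit.
Unset Printing Implicit Defensive.

Import Order.TTheory GRing.Theory Num.Theory.
Import numFieldNormedType.Exports.

Local Open Scope classical_set_scope.
Local Open Scope ring_scope.

Definition is_prob_density (R : realType) (I : set R) (f : R -> R) : Prop :=
  [/\ measurable_fun I f,
      forall t, I t -> 0 <= f t
    & (\int[lebesgue_measure]_(t in I) (f t)%:E = 1)%E].

(* P(A | B); only meaningful when P B != 0. *)
Definition cond_prob (d : measure_display) (T : measurableType d)
    (R : realType) (P : probability T R) (A B : set T) : R :=
  fine (P (A `&` B)) / fine (P B).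

(* Densities are determined only up to null sets: this says that f is a version
   of the density, on I, of the law of Y conditioned on the event B. *)
Definition is_cond_density (d : measure_display) (T : measurableType d)
    (R : realType) (P : probability T R) (I : set R) (B : set T)
    (Y : T -> R) (f : R -> R) : Prop :=
  is_prob_density I f /\
  forall A : set R, measurable A -> A `<=` I ->
    ((cond_prob P (Y @^-1` A) B)%:E =
       \int[lebesgue_measure]_(t in A) (f t)%:E)%E.

(* The random elements other than the process: the interval [angles] in which
   polarization angles live, the density of theta_0, the transmission
   probabilities [PT i theta_i alpha_i] and the transition densities
   [rhoC i theta_i theta_(i+1) alpha_i]. *)
Record case1_data (R : realType) (M : nat) := Case1Data {
  angles : interval R ;
  rhoS0 : R -> R ;
  PT : 'I_M -> R -> R -> R ;
  rhoC : 'I_M -> R -> R -> R -> R ;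
  angles_length : lebesgue_measure [set` angles] = (2 * pi)%:E ;
  rhoS0_density : is_prob_density [set` angles] rhoS0 ;
  PT_measurable : forall i a,
    measurable_fun [set` angles] (fun t => PT i t a) ;
  PT_prob : forall i a t, t \in angles -> 0 <= PT i t a <= 1 ;
  rhoC_measurable : forall i a,
    measurable_fun ([set` angles] `*` [set` angles])
      (fun tt => rhoC i tt.1 tt.2 a) ;
  rhoC_density : forall i a t, t \in angles ->
    is_prob_density [set` angles] (fun t' => rhoC i t t' a) }.

(* History up to the surface i of one photon, where [reach j] is the event that
   the photon passes through the surface j and [theta j] is its polarization
   angle there.  The value of [theta j] outside [reach j] is junk, hence the
   intersections; [B = setT] gives the events [reach j] themselves. *)
Definition history (d : measure_display) (T : measurableType d) (R : realType)
    (reach : nat -> set T) (theta : nat -> T -> R) (i : nat) : set (set T) :=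
  <<s [set E | exists j (B : set R),
         [/\ (j <= i)%N, measurable B & E = reach j `&` theta j @^-1` B] ]>>.

(* Surfaces are indexed by 0, ..., M; [reach i] and [theta i] with i > M are
   unconstrained and unused. *)
Record is_photon (d : measure_display) (T : measurableType d) (R : realType)
    (P : probability T R) (M : nat) (D : case1_data R M) (alpha : 'I_M -> R)
    (reach : nat -> set T) (theta : nat -> T -> R) : Prop := {
  reach_measurable : forall i, (i <= M)%N -> measurable (reach i) ;
  theta_measurable : forall i, (i <= M)%N ->
    measurable_fun (reach i) (theta i) ;
  theta_range : forall i w, (i <= M)%N -> reach i w ->
    theta i w \in angles D ;
  reach0 : reach 0%N = setT ;
  reachS : forall i : 'I_M, reach i.+1 `<=` reach i ;
  theta0_law : forall A : set R, measurable A -> A `<=` [set` angles D] ->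
    (P (theta 0%N @^-1` A) =
       \int[lebesgue_measure]_(t in A) (rhoS0 D t)%:E)%E ;
  (* On [reach i], the conditional probability of transmission through the
     element i given the whole history is PT i (theta i) (alpha i). *)
  transmission_markov : forall (i : 'I_M) (E : set T),
    history reach theta i E ->
    (P (reach i.+1 `&` E) =
       \int[P]_(w in reach i `&` E) (PT D i (theta i w) (alpha i))%:E)%E ;
  (* Given the whole history and the transmission through the element i, the
     outgoing angle has density rhoC i (theta i) _ (alpha i). *)
  angle_markov : forall (i : 'I_M) (E : set T) (A : set R),
    history reach theta i E -> measurable A -> A `<=` [set` angles D] ->
    (P (reach i.+1 `&` theta i.+1 @^-1` A `&` E) =
       \int[P]_(w in reach i.+1 `&` E)
         \int[lebesgue_measure]_(t in A)
           (rhoC D i (theta i w) t (alpha i))%:E)%E }.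

Definition mutually_independent (d : measure_display) (T : measurableType d)
    (R : realType) (P : probability T R) (n : nat)
    (F : 'I_n -> set (set T)) : Prop :=
  forall (J : {set 'I_n}) (E : 'I_n -> set T),
    (forall k, k \in J -> F k (E k)) ->
    (P (\bigcap_(k in [set` J]) E k) = \prod_(k in J) P (E k))%E.

(* N0 independent photons, labelled by k : 'I_N0. *)
Record is_case1_process (d : measure_display) (T : measurableType d)
    (R : realType) (P : probability T R) (M N0 : nat) (D : case1_data R M)
    (alpha : 'I_M -> R)
    (reach : 'I_N0 -> nat -> set T) (theta : 'I_N0 -> nat -> T -> R) : Prop := {
  each_photon : forall k, is_photon P D alpha (reach k) (theta k) ;
  independent_photons :
    mutually_independent P (fun k => history (reach k) (theta k) M) }.

(* N_i(alpha): the expected number of photons passing through the surface i. *)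
Definition photon_number (d : measure_display) (T : measurableType d)
    (R : realType) (P : probability T R) (N0 : nat)
    (reach : 'I_N0 -> nat -> set T) (i : nat) : R :=
  fine 'E_P[fun w => \sum_(k < N0) \1_(reach k i) w].

(* [rhoS i] is the density of the polarization angle at the surface i
   conditioned on reaching that surface.  It is unconstrained when this has
   probability 0; it is then only used multiplied by photon_number = 0. *)
Definition is_state_density (d : measure_display) (T : measurableType d)
    (R : realType) (P : probability T R) (M N0 : nat) (D : case1_data R M)
    (reach : 'I_N0 -> nat -> set T) (theta : 'I_N0 -> nat -> T -> R)
    (rhoS : nat -> R -> R) : Prop :=
  forall (k : 'I_N0) (i : nat), (i <= M)%N -> P (reach k i) != 0%E ->
    is_cond_density P [set` angles D] (reach k i) (theta k i) (rhoS i).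

Section photon_number_facts.
Context (d : measure_display) (T : measurableType d) (R : realType)
        (P : probability T R).

Let law_integral (I : set R) (z : R) (B B' : set T) (Y Y' : T -> R)
    (g : R -> \bar R) :
  measurable I -> ~ I z -> measurable B -> measurable B' ->
  measurable_fun B Y -> measurable_fun B' Y' ->
  (forall A, measurable A -> A `<=` I ->
     P (B `&` Y @^-1` A) = P (B' `&` Y' @^-1` A)) ->
  measurable_fun I g -> (forall t, I t -> (0 <= g t)%E) ->
  forall A, measurable A -> A `<=` I ->
  (\int[P]_(w in B `&` Y @^-1` A) g (Y w) =
   \int[P]_(w in B' `&` Y' @^-1` A) g (Y' w))%E.
Proof.
move=> mI Iz mB mB' mY mY' eqP mg g0 A mA AI.
have aux C (X : T -> R) : measurable C -> measurable_fun C X ->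
    exists X' : T -> R, [/\ measurable_fun setT X',
      forall D, D `<=` I -> X' @^-1` D = C `&` X @^-1` D
      & forall w, C w -> X w = X' w].
  move=> mC mX; exists (fun w => if w \in C then X w else z); split.
  - apply: measurable_fun_if => //.
    + apply: (measurable_fun_bool true).
      rewrite setTI [X in measurable X](_ : _ = C) //.
      by apply/seteqP; split => w /=; [move/set_mem | move/mem_set].
    + rewrite setTI [X in measurable_fun X _](_ : _ = C) //.
      by apply/seteqP; split => w /=; [move/set_mem | move/mem_set].
  - move=> D DI; apply/seteqP; split => w /=.
      by case: ifPn => [/set_mem //|_ /DI].
    by move=> [/mem_set ->].
  - by move=> w /mem_set ->.
have [X [mX XE XY]] := aux _ _ mB mY.
have [X' [mX' XE' XY']] := aux _ _ mB' mY'.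
rewrite -XE// -XE'//.
transitivity (\int[P]_(w in X @^-1` A) (g \o X) w)%E.
  apply: eq_integral => w; rewrite inE XE// => -[Bw _] /=.
  by rewrite XY.
transitivity (\int[P]_(w in X' @^-1` A) (g \o X') w)%E; last first.
  apply: eq_integral => w; rewrite inE XE'// => -[Bw _] /=.
  by rewrite XY'.
have mgA : measurable_fun A g by apply: measurable_funS mg.
have gA : {in A, forall y, 0 <= g y}%E by move=> y /set_mem /AI /g0.
rewrite -(ge0_integral_pushforward mX P mA mgA gA).
rewrite -(ge0_integral_pushforward mX' P mA mgA gA).
apply: eq_measure_integral => E mE EA.
have EI := subset_trans EA AI.
by have := eqP E mE EI; rewrite -XE// -XE'.
Qed.

Context (M N0 : nat) (D : case1_data R M) (alpha : 'I_M -> R).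
Let I := [set` angles D].

Let mI : measurable I. Proof. exact: measurable_itv. Qed.

Let junk : exists z, ~ I z.
Proof.
apply/existsNP => IT; have := angles_length D.
have -> : [set` angles D] = [set` `]-oo, +oo[ : interval R].
  by apply/seteqP; split=> x _; [rewrite set_itvE|exact: IT].
by rewrite lebesgue_measure_itv.
Qed.

Let photon_law reach theta reach' theta' :
  is_photon P D alpha reach theta -> is_photon P D alpha reach' theta' ->
  forall i, (i <= M)%N -> forall A : set R, measurable A -> A `<=` I ->
  P (reach i `&` theta i @^-1` A) = P (reach' i `&` theta' i @^-1` A).
Proof.
move=> ph ph'; have [z Iz] := junk.
elim=> [_ A mA AI|i IH iM A mA AI].
  by rewrite (reach0 ph) (reach0 ph') !setTI (theta0_law ph)// (theta0_law ph').
have {IH} := IH (ltnW iM).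
set j := Ordinal iM; rewrite -[i]/(val j) => IH.
have hist (r : nat -> set T) (t : nat -> T -> R) C :
    measurable C -> history r t j (r j `&` t j @^-1` C).
  by move=> mC; apply: sub_sigma_algebra; exists j, C.
have mr r t (h : is_photon P D alpha r t) := reach_measurable h (ltnW iM).
have mr' r t (h : is_photon P D alpha r t) := reach_measurable h iM.
have mt r t (h : is_photon P D alpha r t) := theta_measurable h (ltnW iM).
have rS r t (h : is_photon P D alpha r t) : r j.+1 `<=` r j.
  by move=> w; exact: (reachS h (i := j)).
have tr C : measurable C -> C `<=` I ->
    P (reach j.+1 `&` theta j @^-1` C) =
    P (reach' j.+1 `&` theta' j @^-1` C).
  move=> mC CI.
  have E r t (h : is_photon P D alpha r t) :
      r j.+1 `&` t j @^-1` C = r j.+1 `&` (r j `&` t j @^-1` C).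
    by rewrite setIA (setIidl (rS _ _ h)).
  rewrite (E _ _ ph) (E _ _ ph') (transmission_markov ph (hist _ _ _ mC)).
  rewrite (transmission_markov ph' (hist _ _ _ mC)).
  rewrite !setIA !setIid.
  apply: (@law_integral I z _ _ _ _ (fun t => (PT D j t (alpha j))%:E)) => //.
  - exact: mr ph.
  - exact: mr ph'.
  - exact: mt ph.
  - exact: mt ph'.
  - apply/measurable_EFinP; exact: PT_measurable.
  - by move=> t It; rewrite lee_fin; have /andP[] := PT_prob j (alpha j) It.
have hT (r : nat -> set T) (t : nat -> T -> R) : history r t j (r j).
  have := hist r t setT measurableT; by rewrite preimage_setT setIT.
have := angle_markov ph (hT _ _) mA AI.
rewrite setIAC (setIidl (rS _ _ ph)) => ->.
have := angle_markov ph' (hT _ _) mA AI.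
rewrite setIAC (setIidl (rS _ _ ph')) => ->.
have J r t (h : is_photon P D alpha r t) : r j.+1 = r j.+1 `&` t j @^-1` I.
  by apply/esym/setIidl => w /(rS _ _ h) /(theta_range h (ltnW iM)).
rewrite [X in integral _ X _](J _ _ ph) [X in _ = integral _ X _](J _ _ ph').
apply: (@law_integral I z _ _ _ _
  (fun s => \int[lebesgue_measure]_(t in A) (rhoC D j s t (alpha j))%:E)%E) => //.
- exact: mr' ph.
- exact: mr' ph'.
- by apply: measurable_funS (mt _ _ ph);
    [exact: (mr _ _ ph)|exact: (rS _ _ ph)].
- by apply: measurable_funS (mt _ _ ph');
    [exact: (mr _ _ ph')|exact: (rS _ _ ph')].
- pose f (p : R * R) : \bar R :=
    (((fun p => (rhoC D j p.1 p.2 (alpha j))%:E) \_ (I `*` A)) p)%E.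
  have mf : measurable_fun setT f.
    apply/(measurable_restrict _ _ _).1 => //; first exact: measurableX.
    rewrite setTI; apply: measurable_funS (_ : measurable_fun (I `*` I) _);
      first exact: measurableX.
      by move=> p [? /AI].
    by apply/measurable_EFinP; exact: rhoC_measurable.
  have f0 p : (0 <= f p)%E.
    rewrite /f patchE; case: ifPn => // /set_mem [p1 /AI p2]; rewrite lee_fin.
    by have [_ + _] := rhoC_density j (alpha j) p1; apply.
  have := @measurable_fun_fubini_tonelli_F _ _ _ _ R lebesgue_measure f mf f0.
  move/(measurable_funS measurableT (@subsetT _ I)); apply: eq_measurable_fun.
  move=> s /set_mem Is; rewrite /fubini_F [RHS]integral_mkcond.
  apply: eq_integral => t _.
  rewrite /f !patchE; congr (if _ then _ else _).
  by apply/idP/idP => [/set_mem[]|/set_mem tA]; rewrite ?inE//.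
- move=> t It; apply: integral_ge0 => s /AI Is; rewrite lee_fin.
  by have [_ + _] := rhoC_density j (alpha j) It; apply.
Qed.

(* All photons have the same law, so that photon_number is N0 times the
   probability that any one of them reaches the surface. *)
Lemma photon_number_reach (reach : 'I_N0 -> nat -> set T)
    (theta : 'I_N0 -> nat -> T -> R) :
  is_case1_process P D alpha reach theta ->
  forall (k : 'I_N0) (i : nat), (i <= M)%N ->
  photon_number P reach i = N0%:R * fine (P (reach k i)).
Proof.
move=> [ph _] k i iM; rewrite /photon_number.
have mr k' := reach_measurable (ph k') iM.
have -> : ('E_P[(fun w => (\sum_(k < N0) \1_(reach k i) w)%R)] =
    \sum_(k' < N0) P (reach k' i))%E.
  rewrite unlock; under eq_integral do rewrite -sumEFin.
  rewrite ge0_integral_sum//.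
  - by apply: eq_bigr => k' _; rewrite integral_indic// setIT.
  - by move=> k'; apply/measurable_EFinP; apply: measurable_indic; exact: mr.
have E k' : P (reach k' i) = P (reach k i).
  have F k2 : reach k2 i = reach k2 i `&` theta k2 i @^-1` I.
    by apply/esym/setIidl => w /(theta_range (ph k2) iM).
  by rewrite (F k) (F k') (photon_law (ph k') (ph k)).
under eq_bigr do rewrite E.
rewrite -(@fineK _ (P (reach k i))) ?fin_num_measure//.
by rewrite sumEFin/= sumr_const card_ord mulr_natl.
Qed.
End photon_number_facts.

(* Main.v *)
(* Transmission at the element [i] applied to the event [reach i] gives
   P(reach (i+1)) as the expectation of [PT i (theta i)] on [reach i].  The
   defining property of [rhoS i] says that the restriction of the law of
   [theta i] to [reach i] has density P(reach i) * rhoS i, so this expectation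
   is the right-hand integral; photons being identically distributed,
   P(reach i) = N_i / N_0. *)
Require Import Defs.
From HB Require Import structures.
From mathcomp Require Import all_boot all_order all_algebra.
From mathcomp Require Import all_classical all_reals all_analysis.
From mathcomp Require Import measurable_realfun.

Set Implicit Arguments.
Unset Strict Implicit.
Unset Printing Implicit Defensive.

Import Order.TTheory GRing.Theory Num.Theory.
Import numFieldNormedType.Exports.

Local Open Scope classical_set_scope.
Local Open Scope ring_scope.

Section integral_against_density.
Context d1 d2 (T1 : measurableType d1) (T2 : measurableType d2) (R : realType).
Variables (P : {measure set T1 -> \bar R}) (mu : {measure set T2 -> \bar R}).
Variables (B : set T1) (I : set T2) (Y : T1 -> T2) (f : T2 -> R).
Hypotheses (mB : measurable B) (mI : measurable I) (mY : measurable_fun B Y).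
Hypotheses (BI : forall w, B w -> I (Y w)).
Hypotheses (mf : measurable_fun I f) (f0 : forall t, I t -> 0 <= f t).
Hypothesis densityP : forall A, measurable A -> A `<=` I ->
  (P (B `&` Y @^-1` A) = \int[mu]_(t in A) (f t)%:E)%E.

Import HBNNSimple.
Local Open Scope ereal_scope.

Let integral_indic_density (A : set T2) : measurable A ->
  \int[P]_(w in B) (\1_A (Y w))%:E = \int[mu]_(t in I) ((f t)%:E * (\1_A t)%:E).
Proof.
move=> mA.
(* [densityP] speaks only of subsets of [I]. As [Y] maps [B] into [I], cutting [A] down to [I]
   leaves its preimage in [B] unchanged. *)
transitivity (P (B `&` Y @^-1` (I `&` A))).
  rewrite (_ : B `&` Y @^-1` (I `&` A) = B `&` Y @^-1` A); last first.
    by apply/seteqP; split => w [Bw]; [case|split => //; split => //; exact: BI].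
  rewrite -[RHS]mul1e -(integral_cst _ _ 1)//; last exact: mY.
  rewrite [RHS]integral_mkcondr; apply: eq_integral => w _.
  by rewrite patchE indicE /=; have [|] := boolP (Y w \in A) => YA;
     [rewrite mem_set//; exact: set_mem|rewrite memNset// => /mem_set; exact/negP].
rewrite densityP//; last exact: measurableI.
rewrite integral_mkcondr; apply: eq_integral => t _.
by rewrite patchE indicE; case: ifPn; rewrite ?mule1 ?mule0.
Qed.

Let integral_nnsfun_density (h : {nnsfun T2 >-> R}) :
  \int[P]_(w in B) (h (Y w))%:E = \int[mu]_(t in I) ((f t)%:E * (h t)%:E).
Proof.
have hE t : (h t)%:E =
    \sum_(y \in range h) (y * \1_(h @^-1` [set y]) t)%:E.
  by rewrite fimfunE -fsumEFin.
(* This holds even for negative [y]: the level set is then empty because [h] is nonnegative, so the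
   term vanishes. *)
have term0 y t : 0 <= (y * \1_(h @^-1` [set y]) t)%:E.
  exact: nnfun_muleindic_ge0.
have mindic y : measurable_fun setT (\1_(h @^-1` [set y]) : T2 -> R).
  exact: measurable_indic.
have mterm y : measurable_fun setT (fun t => (y * \1_(h @^-1` [set y]) t)%:E).
  by apply/measurable_EFinP; exact: measurable_funM.
have mfE : measurable_fun I (EFin \o f) by exact/measurable_EFinP.
under eq_integral do rewrite hE.
under [RHS]eq_integral do rewrite hE ge0_mule_fsumr//.
rewrite ge0_integral_fsum//; last first.
  by move=> y; exact: (measurableT_comp (mterm y) mY).
rewrite ge0_integral_fsum//; last 2 first.
- by move=> y; apply: emeasurable_funM => //; exact: measurable_funTS.
- by move=> y t It; rewrite mule_ge0 ?term0// lee_fin f0.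
(* The sum runs over the range of [h], so each scalar is some value [h t0]; it is therefore
   nonnegative and can leave both integrals. *)
apply: eq_fsbigr => y /set_mem [t0 _ <-{y}].
have ht0 : (0 <= h t0)%R by [].
under eq_integral do rewrite EFinM.
under [RHS]eq_integral do rewrite EFinM muleCA.
rewrite ge0_integralZl_EFin//; last first.
  exact/measurable_EFinP/(measurableT_comp (mindic _) mY).
rewrite ge0_integralZl_EFin//; last 2 first.
- by move=> t It; rewrite mule_ge0 ?lee_fin ?f0.
- by apply: emeasurable_funM => //; exact/measurable_EFinP/measurable_funTS.
by rewrite integral_indic_density.
Qed.

(** Change of variables for a map [Y] that is controlled only on [B]. Indicators are covered by
    [densityP], simple functions by linearity, and monotone convergence along simple approximations
    of [g] gives the rest. *)
Lemma ge0_integral_density (g : T2 -> \bar R) :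
  measurable_fun I g -> (forall t, I t -> 0 <= g t) ->
  \int[P]_(w in B) g (Y w) = \int[mu]_(t in I) ((f t)%:E * g t).
Proof.
move=> mg g0; pose h := nnsfun_approx mI mg.
have hg t : I t -> (h n t)%:E @[n --> \oo] --> g t.
  by move=> It; exact: cvg_nnsfun_approx.
have nd_h t : {homo (fun n => (h n t)%:E) : m n / (m <= n)%N >-> m <= n}.
  by move=> m n mn; rewrite lee_fin; exact/lefP/nd_nnsfun_approx.
have mh n : measurable_fun setT (h n) by exact: measurable_funP.
have cvgP : \int[P]_(w in B) (h n (Y w))%:E @[n --> \oo] -->
    \int[P]_(w in B) g (Y w).
  (* The approximations converge to [g] on [I] only, which suffices because [Y w] lies in [I] for
     [w] in [B]. *)
  rewrite (eq_integral (fun w => limn (fun n => (h n (Y w))%:E))); last first.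
    by move=> w /set_mem /BI IYw; apply/esym/cvg_lim => //; exact: hg.
  apply: cvg_monotone_convergence => //.
  - by move=> n; exact/measurable_EFinP/(measurableT_comp (mh n) mY).
  - by move=> n w _; rewrite lee_fin.
have cvgmu : \int[mu]_(t in I) ((f t)%:E * (h n t)%:E) @[n --> \oo] -->
    \int[mu]_(t in I) ((f t)%:E * g t).
  rewrite (eq_integral (fun t => limn (fun n => (f t)%:E * (h n t)%:E)));
      last first.
    move=> t /set_mem It; apply/esym/cvg_lim => //.
    by apply: cvgeZl => //; exact: hg.
  apply: cvg_monotone_convergence => //.
  - move=> n; apply: emeasurable_funM; apply/measurable_EFinP => //.
    exact: measurable_funTS.
  - by move=> n t It; rewrite mule_ge0// lee_fin//; exact: f0.
  - by move=> t It m n mn; rewrite lee_wpmul2l ?lee_fin ?f0//; exact: nd_h.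
have hE n := integral_nnsfun_density (h n).
(* By [hE] the two sequences of integrals coincide, so their limits do. *)
by move: cvgP; rewrite (funext hE) => /cvg_unique; exact.
Qed.

End integral_against_density.

(** Multiplying by the mass of [B] cancels the division in [cond_prob], so the conditional density
    becomes a density of the unnormalized law of [Y] on [B]. *)
Lemma state_density_mass (R : realType) (d : measure_display)
    (T : measurableType d) (P : probability T R) (I : set R) (B : set T)
    (Y : T -> R) (f : R -> R) :
  measurable I -> measurable B -> measurable_fun B Y -> P B != 0%E ->
  is_cond_density P I B Y f ->
  forall A, measurable A -> A `<=` I ->
  (P (B `&` Y @^-1` A) =
   \int[lebesgue_measure]_(t in A) (fine (P B) * f t)%:E)%E.
Proof.
move=> mI mB mY PB0 [[mf f0 _] law] A mA AI.
have mBA : measurable (Y @^-1` A `&` B) by rewrite setIC; exact: mY.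
have fineB : fine (P B) != 0.
  by apply: contra_neq PB0 => e; rewrite -[LHS]fineK ?fin_num_measure// e.
under eq_integral do rewrite EFinM.
rewrite ge0_integralZl_EFin ?fine_ge0//; last 2 first.
- by move=> t /AI /f0; rewrite lee_fin.
- by apply/measurable_EFinP; exact: measurable_funS mf.
rewrite -law// /cond_prob setIC -EFinM mulrC divfK// fineK//.
exact: fin_num_measure.
Qed.

(** The event [reach i] belongs to its own history, as the generator with [B = setT], so the Markov
    property applies to it; [reachS] then absorbs the intersection. *)
Lemma photon_transmission (R : realType) (M : nat) (D : case1_data R M)
    (alpha : 'I_M -> R) (d : measure_display) (T : measurableType d)
    (P : probability T R) (reach : nat -> set T) (theta : nat -> T -> R) :
  is_photon P D alpha reach theta -> forall i : 'I_M,
  (P (reach i.+1) =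
   \int[P]_(w in reach i) (PT D i (theta i w) (alpha i))%:E)%E.
Proof.
move=> ph i.
have hist : history reach theta i (reach i).
  by apply: sub_sigma_algebra; exists i, setT; rewrite preimage_setT setIT.
by have := transmission_markov ph hist; rewrite setIid (setIidl (reachS ph (i := i))).
Qed.

Theorem mainTheorem5 (R : realType) (M N0 : nat) (hM : (1 <= M)%N)
    (hN0 : N0 <> 0%N) (D : case1_data R M) (alpha : 'I_M -> R)
    (d : measure_display) (T : measurableType d) (P : probability T R)
    (reach : 'I_N0 -> nat -> set T) (theta : 'I_N0 -> nat -> T -> R)
    (rhoS : nat -> R -> R)
    (hproc : is_case1_process P D alpha reach theta)
    (hrhoS : is_state_density P D reach theta rhoS) :
  let N := photon_number P reach in
  forall i : 'I_M,
    ((N i.+1 / N0%:R)%:E =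
       \int[lebesgue_measure]_(t in [set` angles D])
         (N i / N0%:R * rhoS i t * PT D i t (alpha i))%:E)%E.
Proof.
move=> N i; have N0_gt0 : (0 < N0)%N by rewrite lt0n; exact/eqP.
(* Since [N0] is nonzero there is a photon 0, and by [photon_number_reach] it represents all the
   others. *)
pose k := Ordinal N0_gt0; have ph := each_photon hproc k.
have iM : (i <= M)%N := ltnW (ltn_ord i).
have NE j : (j <= M)%N -> N j / N0%:R = fine (P (reach k j)).
  move=> jM; rewrite /N (photon_number_reach hproc k jM) mulrC mulKf//.
  by rewrite pnatr_eq0; exact/eqP.
rewrite (NE _ (ltn_ord i)) (NE _ iM).
have mr := reach_measurable ph iM; have mt := theta_measurable ph iM.
rewrite fineK ?fin_num_measure//; last exact: (reach_measurable ph (ltn_ord i)).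
(* If surface [i] is almost surely not reached, [rhoS i] is arbitrary, but both sides vanish: the
   left by monotonicity of [P], the right through the factor [fine (P (reach k i))]. *)
have [Pi0|Pi0] := eqVneq (P (reach k i)) 0%E.
  rewrite Pi0 integral0_eq => [|t _]; last by rewrite !mul0r.
  apply: (subset_measure0 _ mr (reachS ph (i := i)) Pi0).
  exact: (reach_measurable ph (ltn_ord i)).
have rhoSP := hrhoS k i iM Pi0; have [[mrho rho0 _] _] := rhoSP.
rewrite (photon_transmission ph); under [RHS]eq_integral do rewrite EFinM.
have law := state_density_mass (measurable_itv (angles D)) mr mt Pi0 rhoSP.
apply: (ge0_integral_density (mu := lebesgue_measure)
  (f := fun t => fine (P (reach k i)) * rhoS i t) mr _ mt _ _ _ law
  (g := fun t => (PT D i t (alpha i))%:E)) => //.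
- by move=> w; exact: (theta_range ph).
- exact: measurable_funM.
- by move=> t It; rewrite mulr_ge0 ?fine_ge0 ?rho0.
- by apply/measurable_EFinP; exact: PT_measurable.
- by move=> t It; rewrite lee_fin; case/andP: (PT_prob i (alpha i) It).
Qed.
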